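(* Fix $p\ge 1$ and let $n\to\infty$. Assume that the penalty function satisfies $$\liminf_{n\to\infty}\ \liminf_{t\to0^+}\ p_{\lambda_n}'(t)/\lambda_n>0 .$$ Assume further that $\nu_0\in\mathcal{E}_0$ satisfies $a_n(\nu_0)=O(n^{-1/2})$ and $b_n(\nu_0)\to0$, and let $\widehat{\nu}_n$ be a local maximizer of $F(\nu)=\ell_n(\nu\mid X)-n\,p_{\lambda_n}(\nu)$ over $\mathcal{D}$ with $\|\widehat{\nu}_n-\nu_0\|=O_P(n^{-1/2}+a_n(\nu_0))$. If $\lambda_n\to0$ and $\lambda_nn^{1/2}\to\infty$, then $$P\big(\mathrm{supp}(\widehat{\nu}_n)=\mathrm{supp}(\nu_0)\big)\to1 .$$
   Context: Data: $X=[x_1|\cdots|x_p]\in\mathbb{R}^{n\times p}$ has $n$ i.i.d. rows from $\mathcal{N}(0,\Sigma_0)$, with $\Sigma_0\in\mathbb{R}^{p\times p}$ positive definite; $\Theta_0:=\Sigma_0^{-1}$. Parameter space: a matrix $\Phi=(\phi_{ij})\in\mathbb{R}^{p\times p}$ is called a DAG if the directed graph on $\{1,\dots,p\}$ with an edge $i\to j$ iff $\phi_{ij}\neq 0$ has no directed cycles (in particular $\phi_{jj}=0$). For a DAG $\Phi=[\phi_1|\cdots|\phi_p]$ and $R=\mathrm{diag}(\rho_1,\dots,\rho_p)$ with all $\rho_j>0$, put $U=(u_{ij})=R+\Phi$ and $\nu=\nu(\Phi,R)=\mathrm{vec}(U)\in\mathbb{R}^{p^2}$. The set of all such $\nu$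 is $\mathcal{D}\subset\mathbb{R}^{p^2}$, with the subspace topology; elements of $\mathcal D$ are identified with pairs $(\Phi,R)$. Define $\Theta(\nu)=\Theta(\Phi,R)=(R-\Phi)(R-\Phi)^T$ and $\mathcal{E}_0=\{\nu\in\mathcal{D}:\Theta(\nu)=\Theta_0\}$. Objective: the log-likelihood is $\ell_n(\nu\mid X)=\sum_{j=1}^p\big[n\log\rho_j-\tfrac12\|\rho_jx_j-X\phi_j\|^2\big]$. For each $\lambda$, $p_\lambda:[0,\infty)\to\mathbb{R}$ is a nonnegative, nondecreasing penalty function (with $p_\lambda'$, $p_\lambda''$ existing wherever they are used), $(\lambda_n)$ is a sequence of regularization parameters, and $p_\lambda(\nu)=\sum_{i\ne j}p_\lambda(|u_{ij}|)$. For $\nu_0\in\mathcal{E}_0$ corresponding to $(\Phi_0,R_0)$ with $\Phi_0=(\phi^0_{ij})$: $a_n(\nu_0)=\max\{|p_{\lambda_n}'(|\phi^0_{ij}|)|:\phi^0_{ij}\ne0\}$ and $b_n(\nu_0)=\max\{|p_{\lambda_n}''(|\phi^0_{ij}|)|:\phi^0_{ij}\ne0\}$. $\mathrm{supp}(\nu)=\{j:\nu_j\neq0\}$ and $\|\cdot\|$ is the Euclidean norm. (Under $b_n(\nu_0)\to0$, the existence of a local maximizer $\widehat\nu_n$ with the stated rate is a separate theorem of the paper.)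
   Formalization: The iterated lower limit on p'_{λ_n}(t)/λ_n is replaced by: for every C>0, liminf_n inf over 0<t≤C n^{-1/2} of p'_{λ_n}(t)/λ_n is positive (p_{λ_n} differentiable there for large n); with the inner limit t→0+ at fixed n the claim is false. *)

(* Defs.v *)
(* MathComp-Analysis, over an arbitrary R : realType. *)
From HB Require Import structures.
From mathcomp Require Import all_boot all_order all_algebra.
From mathcomp Require Import all_classical all_reals all_analysis.

Set Implicit Arguments.
Unset Strict Implicit.
Unset Printing Implicit Defensive.

Import Order.TTheory GRing.Theory Num.Theory.
Import numFieldNormedType.Exports.

Local Open Scope classical_set_scope.
Local Open Scope ring_scope.

(* A parameter nu = vec (R + Phi) in R^(p^2) is represented by the p x p matrix
   U = R + Phi itself: [vec] is a linear homeomorphism which preserves the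
   Euclidean norm and transports the support (a set of coordinates) to a set of
   matrix positions. *)
Section Dags.
Context {R : realType} {p : nat}.
Implicit Types (Phi U : 'M[R]_p).

Definition posdefmx (S : 'M[R]_p) : Prop :=
  S^T = S /\ forall v : 'cV[R]_p, v != 0 -> 0 < (v^T *m S *m v) 0 0.

Definition edge Phi : rel 'I_p := fun i j => Phi i j != 0.

(* [cycle e [:: i]] means [e i i], so a DAG has zero diagonal. *)
Definition is_DAG Phi : Prop :=
  forall c : seq 'I_p, cycle (edge Phi) c -> c = [::].

Definition rho_of U : 'rV[R]_p := \row_j U j j.
Definition Rpart U : 'M[R]_p := diag_mx (rho_of U).
Definition Phipart U : 'M[R]_p := U - Rpart U.

Definition DAGspace : set 'M[R]_p :=
  [set U | is_DAG (Phipart U) /\ forall j, 0 < rho_of U 0 j].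

Definition Theta U : 'M[R]_p :=
  (Rpart U - Phipart U) *m (Rpart U - Phipart U)^T.

Definition equivDAGs (Sigma0 : 'M[R]_p) : set 'M[R]_p :=
  [set U | DAGspace U /\ Theta U = invmx Sigma0].

Definition supp U : {set 'I_p * 'I_p} := [set ij | U ij.1 ij.2 != 0]%SET.

(* The Euclidean norm; the library's norm on matrices is the max norm. *)
Definition enorm m n (A : 'M[R]_(m, n)) : R :=
  Num.sqrt (\sum_i \sum_j A i j ^+ 2).

Definition loglik n (X : 'M[R]_(n, p)) U : R :=
  \sum_j (n%:R * ln (rho_of U 0 j)
          - 2^-1 * enorm (rho_of U 0 j *: col j X - X *m col j (Phipart U)) ^+ 2).

(* [pen lam t] is p_lam(t); only its values at t >= 0 are ever used. *)
Definition penalty (pen : R -> R) U : R :=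
  \sum_i \sum_(j | i != j) pen `|U i j|.

Definition objective n (X : 'M[R]_(n, p)) (pen : R -> R) U : R :=
  loglik X U - n%:R * penalty pen U.

(* Maxima of nonnegative quantities, equal to 0 when Phi0 = 0. *)
Definition pen_a (pen : R -> R) U0 : R :=
  \big[Num.max/0]_(ij : 'I_p * 'I_p | Phipart U0 ij.1 ij.2 != 0)
    `|derive1 pen `|Phipart U0 ij.1 ij.2| |.

Definition pen_b (pen : R -> R) U0 : R :=
  \big[Num.max/0]_(ij : 'I_p * 'I_p | Phipart U0 ij.1 ij.2 != 0)
    `|derive1 (derive1 pen) `|Phipart U0 ij.1 ij.2| |.

End Dags.

Section Penalty.
Context {R : realType}.

Definition twice_derivable_at (f : R -> R) (t : R) : Prop :=
  (\forall s \near t, derivable f s 1) /\ derivable (derive1 f) t 1.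

(* liminf_n liminf_(t -> 0+) p_(lam n)'(t) / lam n > 0, the inner lower limit
   being taken at the scale t = O(n^(-1/2)): for every C > 0,
     liminf_n inf_(0 < t <= C n^(-1/2)) p_(lam n)'(t) / lam n > 0.
   Letting t -> 0+ first, for each fixed n separately, would only constrain
   p_(lam n)' on a neighbourhood of 0 which may shrink arbitrarily fast with n,
   whereas the nonzero entries of a root-n consistent estimator that estimate
   a zero parameter are only known to be O_P(n^(-1/2)). *)
Definition steep_at_origin (pen : R -> R -> R) (lam : nat -> R) : Prop :=
  forall C : R, 0 < C ->
    let window n := [set t : R | 0 < t <= C / Num.sqrt n%:R] in
    (\forall n \near \oo, forall t, window n t -> derivable (pen (lam n)) t 1) /\
    (0 < limn_einf (fun n : nat =>
           ereal_inf [set (derive1 (pen (lam n)) t / lam n)%:E | t in window n]))%E.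

End Penalty.

Section Probability.
Context {R : realType} {d : measure_display} {T : measurableType d}.
Variable P : probability T R.

Definition borel_mx m n : set (set 'M[R]_(m, n)) := <<s open >>.

Definition random_mx m n (A : T -> 'M[R]_(m, n)) : Prop :=
  forall B, borel_mx B -> measurable (A @^-1` B).

(* N(0, S) for positive definite S: every nonzero linear combination of the
   coordinates is univariate normal with the corresponding variance (the second
   parameter of [normal_prob] is the standard deviation). *)
Definition gaussian_row p (S : 'M[R]_p) (x : T -> 'rV[R]_p) : Prop :=
  random_mx x /\
  forall a : 'cV[R]_p, a != 0 -> forall B : set R, measurable B ->
    P [set w | B ((x w *m a) 0 0)]
    = normal_prob 0 (Num.sqrt ((a^T *m S *m a) 0 0)) B.

(* The B k may be the full space, so every subfamily is covered. *)
Definition independent_rows n p (X : T -> 'M[R]_(n, p)) : Prop :=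
  forall B : 'I_n -> set 'rV[R]_p, (forall k, borel_mx (B k)) ->
    P [set w | forall k, B k (row k (X w))]
    = (\prod_(k < n) P [set w | B k (row k (X w))])%E.

Definition iid_gaussian_rows n p (S : 'M[R]_p) (X : T -> 'M[R]_(n, p)) : Prop :=
  (forall k, gaussian_row S (fun w => row k (X w))) /\ independent_rows X.

(* Y_n = O_P(r_n) *)
Definition bounded_in_prob (Y : nat -> T -> R) (r : nat -> R) : Prop :=
  forall eps : R, 0 < eps -> exists2 M : R, 0 < M &
    \forall n \near \oo, (P [set w | (M * r n < `|Y n w|)%R] <= eps%:E)%E.

(* E n holds with probability tending to one; E n need not be measurable. *)
Definition with_prob_to_one (E : nat -> set T) : Prop :=
  exists A : nat -> set T,
    [/\ forall n, measurable (A n), forall n, A n `<=` E n &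
        P (A n) @[n --> \oo] --> (1%:E : \bar R)].

End Probability.

(* Local maximality over D for the subspace topology. *)
Definition local_maximizer {R : realType} {X : topologicalType}
    (D : set X) (F : X -> R) (x : X) : Prop :=
  D x /\ \forall y \near within D (nbhs x), F y <= F x.

(* Main.v *)
Require Import Defs.
From HB Require Import structures.
From mathcomp Require Import all_boot all_order all_algebra.
From mathcomp Require Import all_classical all_reals all_analysis.
From mathcomp Require Import measurable_realfun ring lra.

Set Implicit Arguments.
Unset Strict Implicit.
Unset Printing Implicit Defensive.

Import Order.TTheory GRing.Theory Num.Theory.
Import numFieldNormedType.Exports.

Local Open Scope classical_set_scope.
Local Open Scope ring_scope.

(* Suppose Uhat has a nonzero entry (i, j) where U0 vanishes.  Perturbing that
   entry alone keeps Uhat in the DAG space, so the first-order condition bounds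
   n p'(|u_ij|) by the score |x_i . (rho_j x_j - X phi_j)| at Uhat.  By
   steepness the left side is at least c n lambda_n, which dominates sqrt n.
   The right side is O_P(sqrt n): since Uhat contains all edges of U0 and is
   acyclic, the edge i -> j excludes a directed path j -> i in U0, hence
   (Sigma0 (R0 - Phi0))_ij = ((R0 - Phi0)^-1)_ji = 0, i.e. the score at U0 is
   centred; replacing Uhat by U0 costs O_P(n) O_P(n^(-1/2)).  By polarization
   the centred score is a difference of two sums of squares of equally
   distributed normal variables, so Chebyshev's inequality, needing only that
   the fourth moment is finite, gives its order without computing moments. *)

(** * Measurability and moments *)

Section Measurability.
Context {R : realType}.

Lemma random_mx_coord d (T : measurableType d) m n (A : T -> 'M[R]_(m, n)) i j :
  random_mx A -> measurable_fun setT (fun w => A w i j).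
Proof.
move=> mA.
apply: (measurability _ (RGenOpens.measurableE R)).
move=> _ [_ [a [b ->] <-]]; rewrite setTI.
apply: (mA [set M : 'M[R]_(m, n) | `]a, b[%classic (M i j)]).
apply: sub_sigma_algebra.
apply: (@open_comp _ _ (fun M : 'M[R]_(m, n) => M i j)); last exact: interval_open.
by move=> M _; exact: coord_continuous.
Qed.

Lemma measurable_mulmx_coord d (T : measurableType d) p (x : T -> 'rV[R]_p)
    (c : 'cV[R]_p) :
  random_mx x -> measurable_fun setT (fun w => (x w *m c) 0 0).
Proof.
move=> mx.
have -> : (fun w => (x w *m c) 0 0) = (fun w => \sum_j x w 0 j * c j 0).
  by apply/funext => w; rewrite mxE.
apply: measurable_sum => j; apply: measurable_funM => //.
exact: random_mx_coord.
Qed.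

Lemma borel_mulmx_preimage p (c : 'cV[R]_p) (B : set R) : measurable B ->
  borel_mx [set x : 'rV[R]_p | B ((x *m c) 0 0)].
Proof.
move=> mB.
(* The identity of the Borel space is itself a random row, so the measurability of linear forms of
   random rows applies to it. *)
have mid : random_mx (fun x : g_sigma_algebraType (@open 'rV[R]_p) => x) by [].
have := measurable_mulmx_coord c mid measurableT mB.
by rewrite setTI.
Qed.

End Measurability.

Section Density.
Context {R : realType}.
Local Open Scope ereal_scope.

Import HBNNSimple.

(** Simple functions increase to [f]. Each satisfies the change of density exactly and lies below
    [f], and monotone convergence passes the bound to the limit. An inequality is enough, since it
    serves only to show that a moment is finite. *)
Lemma le_integral_density d (T : measurableType d)
    (mu nu : {measure set T -> \bar R}) (g : T -> R) (f : T -> \bar R) :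
  measurable_fun setT g -> (forall x, 0 <= g x)%R ->
  (forall B, measurable B -> nu B = \int[mu]_(x in B) (g x)%:E) ->
  measurable_fun setT f -> (forall x, 0 <= f x) ->
  \int[nu]_x f x <= \int[mu]_x (f x * (g x)%:E).
Proof.
move=> mg g0 nuE mf f0.
have mfg : measurable_fun setT (fun x => f x * (g x)%:E).
  by apply: emeasurable_funM => //; exact/measurable_EFinP.
pose f_ := nnsfun_approx measurableT mf.
have -> : \int[nu]_x f x = lim (\int[nu]_x (f_ n x)%:E @[n --> \oo]).
  rewrite -monotone_convergence//=.
  - apply: eq_integral => ? /[!inE] xD; apply/esym/cvg_lim => //=.
    exact: cvg_nnsfun_approx.
  - by move=> n; exact/measurable_EFinP/measurable_funTS.
  - by move=> n ? _; rewrite lee_fin.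
  - by move=> ? _ ? ? mn; rewrite lee_fin; exact/lefP/nd_nnsfun_approx.
apply: lime_le.
  apply/ereal_nondecreasing_is_cvgn => x y xy; apply: ge0_le_integral => //=.
  - by move=> ? _; rewrite lee_fin.
  - exact/measurable_EFinP/measurable_funTS.
  - exact/measurable_EFinP/measurable_funTS.
  - by move=> ? _; rewrite lee_fin; exact/lefP/nd_nnsfun_approx.
apply: nearW => n.
(* For a simple function both sides are finite sums over its values; the terms agree by the density
   formula on each level set. *)
have -> : \int[nu]_x (f_ n x)%:E = \int[mu]_x ((f_ n x)%:E * (g x)%:E).
  under [LHS]eq_integral do rewrite fimfunE -fsumEFin//.
  rewrite [LHS]ge0_integral_fsum//; last 2 first.
    - by move=> r; exact/measurable_EFinP/measurableT_comp.
    - by move=> m x _; rewrite EFinM nnfun_muleindic_ge0.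
  under [RHS]eq_integral.
    move=> x xD; rewrite fimfunE -fsumEFin// ge0_mule_fsuml; last first.
      by move=> r; rewrite EFinM nnfun_muleindic_ge0.
    over.
  rewrite [RHS]ge0_integral_fsum//; last 2 first.
    - move=> r; apply: emeasurable_funM; apply/measurable_EFinP => //.
      exact/measurableT_comp.
    - move=> m x _; apply: mule_ge0; last by rewrite lee_fin.
      by rewrite EFinM nnfun_muleindic_ge0.
  apply: eq_fsbigr => r; rewrite inE/= => -[t _ rt].
  have r0 : (0 <= r)%R by rewrite -rt.
  have mr : measurable (f_ n @^-1` [set r]) by [].
  under [RHS]eq_integral do rewrite EFinM -muleA.
  rewrite integralZl_indic_nnsfun//= integral_indic// setIT nuE//.
  rewrite ge0_integralZl//; last 2 first.
    - apply: emeasurable_funM; apply/measurable_EFinP => //.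
    - by move=> x _; rewrite mule_ge0 ?lee_fin.
  congr (_ * _); rewrite [LHS]integral_mkcond/=.
  apply: eq_integral => x _; rewrite patchE indicE.
  by case: ifPn => _; rewrite ?mul1e ?mul0e.
apply: ge0_le_integral => //=.
- by move=> x _; rewrite mule_ge0 ?lee_fin.
- by apply: emeasurable_funM; apply/measurable_EFinP.
- move=> x _; rewrite lee_wpmul2r ?lee_fin//.
  have cf := @cvg_nnsfun_approx _ _ _ _ measurableT _ mf (fun x _ => f0 x) x I.
  rewrite -(cvg_lim (@ereal_hausdorff R) cf)//; apply: lime_ge.
    exact: (cvgP _ cf).
  exists n => // m /= nm; rewrite lee_fin.
  by have /lefP := nd_nnsfun_approx measurableT mf nm.
Qed.

(** Doubling the standard deviation absorbs the polynomial. With [y = x^2 / (8 s^2)] the two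
    Gaussian exponents are [-4y] and [-y], and [y^2 exp(-3y) <= 1], so the integrand is at most [K]
    times the density of standard deviation [2s]. *)
Lemma normal_fourth_moment (s : R) : (s != 0)%R ->
  \int[normal_prob 0 s]_x (x ^+ 4)%:E < +oo.
Proof.
move=> s0.
pose s' : R := (2 * s)%R.
have s'0 : (s' != 0)%R by rewrite mulf_neq0.
pose K : R := ((8 * s ^+ 2) ^+ 2 * normal_peak s / normal_peak s')%R.
apply: (@le_lt_trans _ _ (\int[lebesgue_measure]_x ((x ^+ 4)%:E * (normal_pdf 0 s x)%:E))).
  apply: le_integral_density => //.
  - exact: measurable_normal_pdf.
  - by move=> x; exact: normal_pdf_ge0.
  - by apply/measurable_EFinP; exact: measurable_funX.
  - by move=> x; rewrite lee_fin exprn_even_ge0.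
apply: (@le_lt_trans _ _ (\int[lebesgue_measure]_x (K%:E * (normal_pdf 0 s' x)%:E))).
  apply: ge0_le_integral => //=.
  - by move=> x _; rewrite -EFinM lee_fin mulr_ge0 ?exprn_even_ge0// normal_pdf_ge0.
  - apply: emeasurable_funM; apply/measurable_EFinP.
      exact: measurable_funX.
    exact: measurable_normal_pdf.
  - apply: emeasurable_funM; apply/measurable_EFinP => //.
    exact: measurable_normal_pdf.
  - move=> x _; rewrite -!EFinM lee_fin !normal_pdfE// /normal_fun !subr0.
    rewrite /K; set a := normal_peak s; set b := normal_peak s'.
    have b0 : b != 0%R by rewrite gt_eqF// normal_peak_gt0.
    have -> : (((8 * s ^+ 2) ^+ 2 * a / b) * (b * expR (- x ^+ 2 / (s' ^+ 2 *+ 2)))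
        = (8 * s ^+ 2) ^+ 2 * a * expR (- x ^+ 2 / (s' ^+ 2 *+ 2)))%R by field.
    pose y : R := (x ^+ 2 / (8 * s ^+ 2))%R.
    have y0 : (0 <= y)%R.
      by apply: divr_ge0; [exact: sqr_ge0|apply: mulr_ge0; [exact: ler0n|exact: sqr_ge0]].
    have -> : (- x ^+ 2 / (s' ^+ 2 *+ 2) = - y)%R by rewrite /y /s'; field; rewrite ?s0.
    have -> : (- x ^+ 2 / (s ^+ 2 *+ 2) = - y + - (3 * y))%R by rewrite /y; field.
    have -> : (x ^+ 4 = (8 * s ^+ 2) ^+ 2 * y ^+ 2)%R by rewrite /y; field.
    (* Since [y <= 1 + y <= exp y] and [1 <= exp y], it follows that
       [y^2 <= exp(y)^2 <= exp(y)^3]. *)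
    have h : (y ^+ 2 * expR (- (3 * y)) <= 1)%R.
      rewrite expRN ler_pdivrMr ?expR_gt0// mul1r.
      have := expR_ge1Dx y; have := expRM_natl 3 y => -> ey.
      have e1 : (1 <= expR y)%R by apply: le_trans ey; rewrite lerDl.
      apply: (@le_trans _ _ (expR y ^+ 2)%R); last by rewrite ler_weXn2l.
      by rewrite lerXn2r ?nnegrE ?expR_ge0// (le_trans _ ey)// lerDr.
    rewrite expRD.
    have := mulr_ge0 (mulr_ge0 (sqr_ge0 (8 * s ^+ 2)) (normal_peak_ge0 s))
       (expR_ge0 (- y)).
    rewrite -/a; set c := (_ * _ * expR _)%R => c0.
    have -> : ((8 * s ^+ 2) ^+ 2 * y ^+ 2 * (a * (expR (- y) * expR (- (3 * y))))
       = c * (y ^+ 2 * expR (- (3 * y))))%R by rewrite /c; ring.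
    by rewrite ler_piMr.
rewrite ge0_integralZl//; last 3 first.
- by apply/measurable_EFinP; exact: measurable_normal_pdf.
- by move=> x _; rewrite lee_fin normal_pdf_ge0.
- by rewrite lee_fin divr_ge0 ?normal_peak_ge0 ?(mulr_ge0 (sqr_ge0 _)) ?normal_peak_ge0.
by rewrite integral_normal_pdf mule1 ltry.
Qed.

End Density.

(** * Chebyshev's inequality for independent sums *)

Section Independence.
Local Open Scope ereal_scope.
Context {R : realType} {d : measure_display} {T : measurableType d}.
Variable P : probability T R.

(** The law of the pair agrees with the product of the marginal laws on rectangles, hence
    everywhere, and Tonelli factors the integral. Nonnegativity dispenses with integrability. *)
Lemma expectationM_indep (Y1 Y2 : T -> R) :
  measurable_fun setT Y1 -> measurable_fun setT Y2 ->
  (forall w, 0 <= Y1 w)%R -> (forall w, 0 <= Y2 w)%R ->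
  (forall A B, measurable A -> measurable B ->
     P ((Y1 @^-1` A) `&` (Y2 @^-1` B)) = P (Y1 @^-1` A) * P (Y2 @^-1` B)) ->
  'E_P[Y1 * Y2] = 'E_P[Y1] * 'E_P[Y2].
Proof.
move=> mY1 mY2 Y10 Y20 indep.
pose X1 : {mfun T >-> R} := HB.pack Y1 (isMeasurableFun.Build _ _ _ _ _ mY1).
pose X2 : {mfun T >-> R} := HB.pack Y2 (isMeasurableFun.Build _ _ _ _ _ mY2).
have mY12 : measurable_fun setT (fun w => (Y1 w, Y2 w)) by exact: measurable_fun_pair.
pose X12 : {mfun T >-> (R * R)%type} :=
  HB.pack (fun w => (Y1 w, Y2 w)) (isMeasurableFun.Build _ _ _ _ _ mY12).
(* The absolute values make the integrand nonnegative on the whole plane; along the pair they change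
   nothing. *)
pose h (z : R * R) := `|z.1%:E| * `|z.2%:E|.
have h0 z : 0 <= h z by exact: mule_ge0.
have mh : measurable_fun setT h.
  by apply: emeasurable_funM; apply: measurableT_comp => //; apply: measurableT_comp.
have mabs : measurable_fun setT (fun x : R => `|x%:E|) by exact: measurableT_comp.
rewrite !unlock.
transitivity (\int[distribution P X12]_z h z).
  rewrite ge0_integral_distribution//; apply: eq_integral => w _ /=.
  by rewrite /h /= !ger0_norm.
rewrite (eq_measure_integral (distribution P X1 \x distribution P X2)); last first.
  move=> A mA _; apply/esym.
  by apply: product_measure_unique => // B C mB mC; exact: indep.
rewrite fubini_tonelli1// /fubini_F /h /=.
under eq_integral => x _ do rewrite ge0_integralZl//.
rewrite ge0_integralZr//; last exact: integral_ge0.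
rewrite !ge0_integral_distribution//; congr (_ * _).
- by apply: eq_integral => w _ /=; rewrite ger0_norm.
- by apply: eq_integral => w _ /=; rewrite ger0_norm.
Qed.

Lemma Lfun2_of_sqr (Y : T -> R) : measurable_fun setT Y ->
  \int[P]_w ((Y w) ^+ 2)%:E < +oo -> Y \in Lfun P 2%:E.
Proof.
move=> mY Y2; rewrite inE; apply/andP; split; rewrite inE//=.
rewrite /finite_norm unlock /=.
rewrite poweR_lty//.
apply: le_lt_trans Y2; rewrite le_eqVlt; apply/orP; left; apply/eqP.
by apply: eq_integral => w _; rewrite powR_mulrn// real_normK// num_real.
Qed.

(** Square integrability of the partial sum is carried through the induction because additivity of
    the covariance requires it at every step. *)
Lemma covariance_sum_eq0 (I : eqType) (s : seq I) (Y : I -> T -> R) (Z : T -> R) :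
  (forall i, Y i \in Lfun P 2%:E) -> Z \in Lfun P 2%:E ->
  {in s, forall i, covariance P Z (Y i) = 0} ->
  (\sum_(i <- s) Y i)%R \in Lfun P 2%:E /\
  covariance P Z (\sum_(i <- s) Y i)%R = 0.
Proof.
move=> Y2 Z2; elim: s => [|a s IH] cov0.
  by rewrite big_nil; split; [exact: Lfun_cst|exact: covariance_cst_r].
have [|S2 cS] := IH; first by move=> i si; apply: cov0; rewrite inE si orbT.
rewrite big_cons; split; first by rewrite rpredD ?lee1n.
by rewrite covarianceDr// cS adde0 cov0// inE eqxx.
Qed.

Lemma variance_sum (I : eqType) (s : seq I) (Y : I -> T -> R) : uniq s ->
  (forall i, Y i \in Lfun P 2%:E) ->
  (forall i j, i != j -> covariance P (Y i) (Y j) = 0) ->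
  'V_P[(\sum_(i <- s) Y i)%R] = \sum_(i <- s) 'V_P[Y i].
Proof.
move=> + Y2 cov0; elim: s => [_|a s IH /= /andP[nas us]].
  by rewrite !big_nil variance_cst.
have [|S2 cS] := @covariance_sum_eq0 _ s Y (Y a) Y2 (Y2 a).
  by move=> i si; apply: cov0; apply: contraNneq nas => ->.
by rewrite !big_cons varianceD// cS mule0 adde0 IH.
Qed.

(** Pairwise factorization removes the covariances, so the variance of the sum is the sum of the
    variances, each [v - m^2 <= v]. *)
Lemma chebyshev_sum n (Y : 'I_n -> T -> R) (m v eps : R) :
  (forall i, measurable_fun setT (Y i)) -> (forall i w, 0 <= Y i w)%R ->
  (forall i, 'E_P[Y i] = m%:E) -> (forall i, 'E_P[Y i ^+ 2] = v%:E) ->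
  (forall i j, i != j -> 'E_P[Y i * Y j] = 'E_P[Y i] * 'E_P[Y j]) ->
  (0 < eps)%R ->
  P [set w | (eps <= `|\sum_i Y i w - n%:R * m|)%R] <= (n%:R * v / eps ^+ 2)%:E.
Proof.
move=> mY Y0 EY EY2 EYY eps0.
have Pfin : P setT \is a fin_num := fin_num_measure P _ measurableT.
have Y2 i : Y i \in Lfun P 2%:E.
  apply: Lfun2_of_sqr => //.
  by have := EY2 i; rewrite unlock /= => ->; rewrite ltry.
have Y1 i : Y i \in Lfun P 1 by exact: Lfun_subset12.
have mS : measurable_fun setT (\sum_i Y i)%R.
  have -> : (\sum_i Y i)%R = (fun w => \sum_i Y i w)%R.
    by apply/funext => w; rewrite fct_sumE.
  exact: measurable_sum.
pose S : {mfun T >-> R} := HB.pack (\sum_i Y i)%R (isMeasurableFun.Build _ _ _ _ _ mS).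
have ES : 'E_P[S] = (n%:R * m)%:E.
  rewrite /S /=; rewrite -(big_map Y xpredT id) expectation_sum.
    rewrite big_map; under eq_bigr do rewrite EY.
    by rewrite sumEFin big_const_ord iter_addr_0 mulr_natl.
  by move=> _ /mapP[i _ ->].
have VS : 'V_P[S] <= (n%:R * v)%:E.
  rewrite /S /= variance_sum ?index_enum_uniq//; last first.
    move=> i j ij; rewrite covarianceE ?Lfun2_mul_Lfun1// EYY// subee//.
    by rewrite fin_numM ?expectation_fin_num.
  apply: (@le_trans _ _ (\sum_(i < n) v%:E)).
    apply: lee_sum => i _; rewrite varianceE// EY2 EY.
    by rewrite -EFin_expe -EFinB lee_fin gerBl sqr_ge0.
  by rewrite sumEFin big_const_ord iter_addr_0 mulr_natl.
have -> : [set w | (eps <= `|\sum_i Y i w - n%:R * m|)%R] =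
          [set w | (eps <= `|S w - fine 'E_P[S]|)%R].
  by apply/seteqP; split => w; rewrite /S /= ES /= fct_sumE.
apply: le_trans (chebyshev S eps0) _.
by rewrite mulrC EFinM; apply: lee_wpmul2l => //; rewrite lee_fin invr_ge0 sqr_ge0.
Qed.

End Independence.

Section GaussianRows.
Local Open Scope ereal_scope.
Context {R : realType} {d : measure_display} {T : measurableType d}.
Variable P : probability T R.

(** [fine] sends an infinite integral to a default value; the next two lemmas rule this out for
    [k = 4] and [k = 2] when [s] is nonzero. *)
Definition normal_moment (s : R) (k : nat) : R :=
  fine (\int[normal_prob 0 s]_x (x ^+ k)%:E).

Lemma normal_moment4E (s : R) : s != 0%R ->
  \int[normal_prob 0 s]_x (x ^+ 4)%:E = (normal_moment s 4)%:E.
Proof.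
move=> s0; rewrite fineK// ge0_fin_numE ?normal_fourth_moment//.
by apply: integral_ge0 => x _; rewrite lee_fin exprn_even_ge0.
Qed.

Lemma normal_moment2E (s : R) : s != 0%R ->
  \int[normal_prob 0 s]_x (x ^+ 2)%:E = (normal_moment s 2)%:E.
Proof.
move=> s0; have m2 k : measurable_fun setT (fun x : R => (x ^+ k)%:E).
  by apply/measurable_EFinP; exact: measurable_funX.
rewrite fineK// ge0_fin_numE; last first.
  by apply: integral_ge0 => x _; rewrite lee_fin sqr_ge0.
(* The second moment is controlled by the fourth through [x^2 <= 1 + x^4]. *)
apply: (@le_lt_trans _ _ (\int[normal_prob 0 s]_x (1 + (x ^+ 4)%:E))).
  apply: ge0_le_integral => //.
  - by move=> x _; rewrite lee_fin sqr_ge0.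
  - exact: m2.
  - exact: (emeasurable_funD (@measurable_cst _ _ _ _ _ 1) (m2 4%N)).
  - move=> x _; rewrite -EFinD lee_fin.
    have := sqr_ge0 (x ^+ 2 - 1 : R)%R.
    have := sqr_ge0 (x : R)%R.
    have -> : (x ^+ 4 = x ^+ 2 * x ^+ 2)%R by ring.
    by move: (x ^+ 2)%R => y; nra.
rewrite ge0_integralD//; [|by move=> x _; rewrite lee_fin exprn_even_ge0|exact: m2].
rewrite integral_cst//= mul1e normal_moment4E//.
by rewrite [normal_prob 0 s setT]probability_setT -EFinD ltry.
Qed.

(** Change of variables to the law of the linear form. An even exponent keeps the integrand
    nonnegative, so no integrability has to be known beforehand. *)
Lemma gaussian_row_moment p (S : 'M[R]_p) (x : T -> 'rV[R]_p) (c : 'cV[R]_p) k :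
  gaussian_row P S x -> c != 0%R -> ~~ odd k ->
  'E_P[fun w => ((x w *m c) 0 0 ^+ k)%R] =
  \int[normal_prob 0 (Num.sqrt ((c^T *m S *m c) 0 0)%R)]_y (y ^+ k)%:E.
Proof.
move=> [mx gx] c0 ek.
have mZ : @measurable_fun _ _ T (measurableTypeR R) setT (fun w => (x w *m c) 0 0)%R.
  exact: measurable_mulmx_coord c mx.
pose Z : {mfun T >-> measurableTypeR R} := HB.pack (fun w => (x w *m c) 0 0)%R
  (isMeasurableFun.Build _ _ _ _ _ mZ).
have mk : measurable_fun setT (fun y : measurableTypeR R => (y ^+ k)%:E).
  by apply/measurable_EFinP; exact: measurable_funX.
have k0 y : 0 <= (y ^+ k)%:E :> \bar R by rewrite lee_fin exprn_even_ge0.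
rewrite unlock -[LHS](@ge0_integral_distribution _ _ _ _ _ P Z _ mk k0).
by apply: eq_measure_integral => A mA _; exact: gx.
Qed.

Lemma indep_rows_pair n p (X : T -> 'M[R]_(n, p)) (k l : 'I_n) (A B : set 'rV[R]_p) :
  independent_rows P X -> k != l -> borel_mx A -> borel_mx B ->
  P ([set w | A (row k (X w))] `&` [set w | B (row l (X w))]) =
  P [set w | A (row k (X w))] * P [set w | B (row l (X w))].
Proof.
move=> indX kl bA bB.
(* All rows other than [k] and [l] are left unconstrained and contribute factors 1 to the
   product. *)
pose C i := if i == k then A else if i == l then B else setT.
have bC i : borel_mx (C i).
  rewrite /C; case: ifP => // _; case: ifP => // _.
  exact: (@measurableT _ (g_sigma_algebraType (@open 'rV[R]_p))).
have := indX C bC.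
rewrite (bigD1 k)//= (bigD1 l)/=; last by rewrite eq_sym.
rewrite big1 ?mule1; last first.
  move=> i /andP[/negbTE ik /negbTE il]; rewrite /C ik il.
  exact: probability_setT.
rewrite /C eqxx eq_sym (negbTE kl) eqxx => <-.
congr (P _); apply/seteqP; split => w /=.
  by move=> [Aw Bw] i; case: eqP => [->//|_]; case: eqP => [->|].
move=> h; split; first by have := h k; rewrite eqxx.
by have := h l; rewrite eq_sym (negbTE kl) eqxx.
Qed.

(** The standard deviation is a separate argument so that different vectors [c] of equal variance
    share literally the same centring. *)
Lemma gaussian_sqnorm_chebyshev n p (S : 'M[R]_p) (X : T -> 'M[R]_(n, p))
    (c : 'cV[R]_p) (s eps : R) : s = Num.sqrt ((c^T *m S *m c) 0 0)%R ->
  posdefmx S -> iid_gaussian_rows P S X -> c != 0%R -> (0 < eps)%R ->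
  P [set w | (eps <= `|\sum_k (X w *m c) k 0 ^+ 2 - n%:R * normal_moment s 2|)%R]
    <= (n%:R * normal_moment s 4 / eps ^+ 2)%:E.
Proof.
move=> sE [_ posS] [gX indX] c0 eps0.
have s0 : s != 0%R by rewrite sE gt_eqF// sqrtr_gt0 posS.
have rowE w k : ((X w *m c) k 0 = (row k (X w) *m c) 0 0 :> R)%R.
  by rewrite -row_mul [RHS]mxE.
pose Y (k : 'I_n) w := ((X w *m c) k 0 ^+ 2)%R.
have YE k : Y k = (fun w => (row k (X w) *m c) 0 0 ^+ 2)%R.
  by apply/funext => w; rewrite /Y rowE.
have mY k : measurable_fun setT (Y k).
  rewrite YE; apply: measurable_funX; apply: measurable_mulmx_coord.
  by case: (gX k).
apply: (@chebyshev_sum _ _ _ P n Y) => //.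
- by move=> k w; exact: sqr_ge0.
- by move=> k; rewrite YE (gaussian_row_moment (gX k))// -sE normal_moment2E.
- move=> k; have -> : (Y k ^+ 2 = fun w => (row k (X w) *m c) 0 0 ^+ 4)%R.
    by rewrite YE; apply/funext => w; rewrite [RHS](exprM _ 2 2).
  by rewrite (gaussian_row_moment (gX k))// -sE normal_moment4E.
- move=> k l kl; apply: expectationM_indep => //.
  + by move=> w; exact: sqr_ge0.
  + by move=> w; exact: sqr_ge0.
  + move=> A B mA mB; rewrite !YE.
    have bsqr (D : set R) : measurable D ->
        borel_mx [set x : 'rV[R]_p | D ((x *m c) 0 0 ^+ 2)%R].
      move=> mD; apply: (@borel_mulmx_preimage _ _ c (fun y : R => D (y ^+ 2)%R)).
      rewrite -[X in measurable X]setTI.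
      exact: (@measurable_funX _ _ _ setT id 2 (@measurable_id _ _ _) measurableT D mD).
    exact: (indep_rows_pair indX kl (bsqr _ mA) (bsqr _ mB)).
Qed.

End GaussianRows.

(** * Directed paths and covariances *)

Section DagAlgebra.
Context {R : realType} {p : nat}.
Implicit Types (Phi U S : 'M[R]_p).

Lemma is_DAG_acyclic Phi k l :
  is_DAG Phi -> edge Phi k l -> ~~ connect (edge Phi) l k.
Proof.
move=> dag kl; apply/negP => /connectP[c lc kE].
have /= := dag (l :: c); rewrite rcons_path lc -kE => /(_ kl) //.
Qed.

Lemma posdefmx_unit S : posdefmx S -> S \in unitmx.
Proof.
move=> [_ posS]; rewrite -row_free_unit -kermx_eq0; apply/negPn/negP => k0.
have u0 : (nz_row (kermx S))^T != 0 by rewrite -trmx0 (inj_eq trmx_inj) nz_row_eq0.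
have uS : nz_row (kermx S) *m S = 0 by apply/sub_kermxP; exact: nz_row_sub.
by have := posS _ u0; rewrite trmxK uS mul0mx mxE ltxx.
Qed.

Lemma Phipart_offdiag U k l : k != l -> Phipart U k l = U k l.
Proof. by move=> /negbTE kl; rewrite !mxE kl mulr0n subr0. Qed.

Lemma Phipart_diag U k : Phipart U k k = 0.
Proof. by rewrite !mxE eqxx mulr1n subrr. Qed.

Lemma Rpart_sub_PhipartE U k l :
  (Rpart U - Phipart U) k l = U l l *+ (k == l) - Phipart U k l.
Proof.
by rewrite !mxE; case: eqP => // ->.
Qed.

(* [Sigma0 (R - Phi)] is the inverse transpose of [R - Phi], and the Neumann
   series of the inverse only sees the directed paths of Phi. *)
Lemma cov_residual_connect (Sigma0 : 'M[R]_p) U i j :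
  posdefmx Sigma0 -> equivDAGs Sigma0 U ->
  (Sigma0 *m (Rpart U - Phipart U)) i j != 0 ->
  connect (edge (Phipart U)) j i.
Proof.
move=> posS [[dag rho0] ThetaE].
set A := Rpart U - Phipart U; set e := edge (Phipart U).
have AAS : A *m (A^T *m Sigma0) = 1%:M.
  by rewrite mulmxA -[A *m A^T]/(Theta U) ThetaE mulVmx// posdefmx_unit.
have ASA := mulmx1C AAS.
have vE l : (Sigma0 *m A) l j = (A^T *m Sigma0) j l.
  by rewrite -[LHS]/((Sigma0 *m A) l j) -(trmxK (Sigma0 *m A)) mxE trmx_mul (proj1 posS).
rewrite {}vE; move: (A^T *m Sigma0) ASA => {AAS} v ASA.
(* Here [v] is the inverse of [A = R - Phi]. Row [j] of [v A = 1] expresses [v j l] through the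
   entries [v j k] at the parents [k] of [l], which unrolls the Neumann series one edge at a
   time. *)
have vA l : v j l * U l l = (j == l)%:R + \sum_k v j k * Phipart U k l.
  have <- : (v *m A) j l = (j == l)%:R by rewrite ASA mxE.
  rewrite mxE.
  under eq_bigr do rewrite Rpart_sub_PhipartE mulrBr.
  rewrite big_split/= sumrN subrK (bigD1 l)//= eqxx mulr1n big1 ?addr0//.
  by move=> k /negbTE ->; rewrite mulr0.
(* Induction on the number of ancestors of [i], itself included. Some parent [k] of [i] has [v j k]
   nonzero; its ancestors are ancestors of [i], but by acyclicity [i] is not among them. *)
have [n] := ubnP #|[pred k | connect e k i]|.
elim: n => // n IH in i *; rewrite ltnS => an vi.
have [->|ji] := eqVneq j i; first exact: connect0.
have ui : U i i != 0 by have := rho0 i; rewrite mxE => /lt0r_neq0.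
have : \sum_k v j k * Phipart U k i != 0.
  by have := vA i; rewrite (negbTE ji) add0r => <-; exact: mulf_neq0.
have [k /andP[vk ki] _|none] := pickP [pred k | (v j k != 0) && e k i]; last first.
  rewrite big1 ?eqxx// => k _; have := none k; rewrite /= /e /edge.
  by case: eqVneq => [->|_ /= /negbFE/eqP ->]; rewrite ?mul0r ?mulr0.
apply: (connect_trans _ (connect1 ki)); apply: IH vk.
apply: leq_trans an; apply/proper_card/properP; split.
  by apply/fintype.subsetP => l; rewrite !inE => /connect_trans; apply; exact: connect1.
exists i; rewrite !inE ?connect0//.
exact: is_DAG_acyclic ki.
Qed.

(** A nonzero entry would give a path from [j] to [i] in [U0]. The inclusion of supports carries it
    over to [U], where the edge from [i] to [j] closes it into a cycle. *)
Lemma supp_edge_cov0 (Sigma0 : 'M[R]_p) U0 U i j :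
  posdefmx Sigma0 -> equivDAGs Sigma0 U0 -> DAGspace U ->
  (forall k l, U0 k l != 0 -> U k l != 0) -> i != j -> U i j != 0 ->
  (Sigma0 *m (Rpart U0 - Phipart U0)) i j = 0.
Proof.
move=> posS eqU0 [dagU _] sub ij uij; apply/eqP/negPn/negP.
move=> /(cov_residual_connect posS eqU0) ji.
have eij : edge (Phipart U) i j by rewrite /edge Phipart_offdiag.
have /negP := is_DAG_acyclic dagU eij; apply.
apply: (connect_sub _ ji) => k l; rewrite /edge => kl.
apply: connect1; rewrite /edge.
have kl' : k != l by apply: contraNneq kl => ->; rewrite Phipart_diag.
by rewrite Phipart_offdiag// sub// -Phipart_offdiag.
Qed.

End DagAlgebra.

(** * First-order condition *)

Section FirstOrder.
Context {R : realType} {p : nat}.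
Implicit Types (U : 'M[R]_p).

Lemma rho_of_line U i j h : i != j -> rho_of (U + h *: delta_mx i j) = rho_of U.
Proof.
move=> ij; apply/rowP => k; rewrite !mxE.
by have [->|] := eqVneq k i; rewrite ?(negbTE ij) ?andbF ?mulr0 ?addr0.
Qed.

Lemma Phipart_line U i j h : i != j ->
  Phipart (U + h *: delta_mx i j) = Phipart U + h *: delta_mx i j.
Proof. by move=> ij; rewrite /Phipart /Rpart rho_of_line// addrAC. Qed.

Lemma line_entry U i j h k l :
  (U + h *: delta_mx i j) k l = U k l + h * ((k == i) && (l == j))%:R.
Proof. by rewrite !mxE. Qed.

(** Moving an entry that is already nonzero creates no edge, and at most deletes one; the diagonal
    stays fixed. *)
Lemma DAGspace_line U i j h : DAGspace U -> i != j -> U i j != 0 ->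
  DAGspace (U + h *: delta_mx i j).
Proof.
move=> [dag rho0] ij uij; split; last by move=> k; rewrite rho_of_line.
move=> c cyc; apply: dag; apply: sub_cycle cyc => k l.
rewrite /edge Phipart_line// line_entry.
have [/andP[/eqP -> /eqP ->] _|_] := boolP (_ && _).
  by rewrite Phipart_offdiag.
by rewrite mulr0 addr0.
Qed.

Lemma enorm_col_sqr n (v : 'cV[R]_n) : enorm v ^+ 2 = \sum_k v k 0 ^+ 2.
Proof.
rewrite sqr_sqrtr; last by do 2 apply: sumr_ge0 => ? _; exact: sqr_ge0.
by apply: eq_bigr => k _; rewrite big_ord1.
Qed.

(** For [i != j] the entry is the partial derivative of the log-likelihood in [phi_ij]. It is linear
    in [U]. *)
Definition score n (X : 'M[R]_(n, p)) U : 'M[R]_p :=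
  X^T *m (X *m (Rpart U - Phipart U)).

(** Only column [j] changes: its residual [r] becomes [r - h x_i]. The criterion is quadratic in
    this direction, so the expansion is exact. *)
Lemma loglik_line n (X : 'M[R]_(n, p)) U i j h : i != j ->
  loglik X (U + h *: delta_mx i j) - loglik X U =
  h * score X U i j - h ^+ 2 / 2 * \sum_k X k i ^+ 2.
Proof.
move=> ij; rewrite /loglik -sumrB (bigD1 j)//= [X in _ + X]big1 ?addr0; last first.
  move=> k kj; rewrite rho_of_line// Phipart_line//.
  suff -> : col k (Phipart U + h *: delta_mx i j) = col k (Phipart U) by rewrite subrr.
  by apply/colP => l; rewrite !mxE (negbTE kj) andbF mulr0 addr0.
rewrite rho_of_line// Phipart_line// !enorm_col_sqr.
set r := rho_of U 0 j *: col j X - X *m col j (Phipart U).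
have rE k : r k 0 = (X *m (Rpart U - Phipart U)) k j.
  rewrite mulmxBr [RHS]mxE /Rpart mul_mx_diag !mxE mulrC; congr (_ + - _).
  by apply: eq_bigr => l _; rewrite !mxE.
have -> : rho_of U 0 j *: col j X - X *m col j (Phipart U + h *: delta_mx i j)
    = r - h *: col i X.
  rewrite raddfD/= mulmxDr opprD addrA; congr (_ - _).
  apply/colP => k; rewrite !mxE (bigD1 i)//= big1 ?addr0 => [|l /negbTE li].
    by rewrite !mxE !eqxx mulr1 mulrC.
  by rewrite !mxE li mulr0 mulr0.
clearbody r.
have -> : score X U i j = \sum_k X k i * r k 0.
  by rewrite mxE; apply: eq_bigr => k _; rewrite rE [X^T _ _]mxE.
have -> : \sum_k (r - h *: col i X) k 0 ^+ 2 = \sum_k r k 0 ^+ 2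
    - 2 * h * \sum_k X k i * r k 0 + h ^+ 2 * \sum_k X k i ^+ 2.
  rewrite !mulr_sumr -sumrN -!big_split/=; apply: eq_bigr => k _.
  have -> : (r - h *: col i X) k 0 = r k 0 - h * X k i by rewrite !mxE.
  by ring.
by field.
Qed.

Lemma penalty_line (pen : R -> R) U i j h : i != j ->
  penalty pen (U + h *: delta_mx i j) - penalty pen U =
  pen `|U i j + h| - pen `|U i j|.
Proof.
move=> ij; rewrite /penalty -sumrB (bigD1 i)//= [X in _ + X]big1 ?addr0; last first.
  move=> k ki; rewrite -sumrB big1// => l kl.
  by rewrite !mxE (negbTE ki) mulr0 addr0 subrr.
rewrite -sumrB (bigD1 j)//= [X in _ + X]big1 ?addr0; last first.
  by move=> l /andP[_ lj]; rewrite !mxE (negbTE lj) andbF mulr0 addr0 subrr.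
by rewrite !mxE !eqxx mulr1.
Qed.

Lemma objective_line n (X : 'M[R]_(n, p)) (pen : R -> R) U i j h : i != j ->
  objective X pen (U + h *: delta_mx i j) - objective X pen U =
  h * score X U i j - h ^+ 2 / 2 * (\sum_k X k i ^+ 2)
  - n%:R * (pen `|U i j + h| - pen `|U i j|).
Proof.
by move=> ij; rewrite -loglik_line// -penalty_line// /objective; ring.
Qed.

(** Shrinking the modulus of the entry saves penalty at rate [n p'(t)] and costs likelihood at rate
    at most the absolute score; at a local maximizer the saving cannot exceed the cost. *)
Lemma local_maximizer_score n (X : 'M[R]_(n, p)) (pen : R -> R) U i j :
  local_maximizer DAGspace (objective X pen) U -> i != j -> U i j != 0 ->
  derivable pen `|U i j| 1 ->
  n%:R * derive1 pen `|U i j| <= `|score X U i j|.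
Proof.
move=> [dagU maxU] ij uij; set t := `|U i j| => dpen.
set G := score X U i j; pose D : R := \sum_k X k i ^+ 2.
have t0 : 0 < t by rewrite normr_gt0.
(* Matrix balls are those of the max norm, and the perturbation has one nonzero entry, of modulus
   [|h|]. *)
have [e e0 maxe] : exists2 e, 0 < e & forall h, `|h| < e ->
    objective X pen (U + h *: delta_mx i j) <= objective X pen U.
  have /nbhs_ballP[e /= e0 he] := maxU; exists e => // h he'.
  apply: he; last exact: DAGspace_line.
  split=> // k l; rewrite /ball /= line_entry opprD addrA subrr add0r normrN normrM.
  case: (_ && _); rewrite ?normr1 ?mulr1// normr0 mulr0//.
(* Moving along the sign of [U i j] with [h < 0] turns the modulus [t] into [t + h]; dividing the
   maximality inequality by the negative [h] reverses it. *)
have quot h : h < 0 -> `|h| < e -> `|h| < t ->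
    n%:R * (h^-1 * (pen (h + t) - pen t)) <= `|G| - h * (D / 2).
  move=> h0 he ht.
  have : objective X pen (U + (Num.sg (U i j) * h) *: delta_mx i j)
       - objective X pen U <= 0.
    by rewrite subr_le0; apply: maxe; rewrite normrM normr_sg uij mul1r.
  rewrite objective_line// -/t -/G -/D.
  have -> : `|U i j + Num.sg (U i j) * h| = h + t.
    rewrite [X in X + _]numEsg -mulrDr normrM normr_sg uij mul1r addrC.
    by rewrite ger0_norm// -/t; move: ht; rewrite ltr0_norm//; lra.
  have -> : (Num.sg (U i j) * h) ^+ 2 = h ^+ 2 by rewrite exprMn sqr_sg uij mul1r.
  have GG : `|Num.sg (U i j) * G| = `|G| by rewrite normrM normr_sg uij mul1r.
  have := ler_norm (Num.sg (U i j) * G); rewrite GG.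
  set s := Num.sg _; set q := pen _ - pen _ => sG hq.
  rewrite mulrCA mulrC ler_ndivrMr//.
  have : (s * G) * (- h) <= `|G| * (- h) by rewrite ler_wpM2r// oppr_ge0 ltW.
  by move: hq; nra.
(* Let [h] tend to 0 from the left: the quotient tends to the derivative and the quadratic term
   vanishes. *)
apply: (@ler_cvg_to R (0 : R)^'- _ R
  (fun h => n%:R * (h^-1 * (pen (h + t) - pen t))) (fun h => `|G| - h * (D / 2))).
- apply: cvgM; first exact: cvg_cst.
  have dpen' : (fun h => h^-1 * (pen (h + t) - pen t)) @ 0^' --> derive1 pen t.
    rewrite /derive1; move: dpen; rewrite /derivable.
    by under eq_fun do rewrite /= [_%:A]mulr1.
  apply: cvg_trans dpen'; apply: cvg_app.
  move=> A [e' e'0 Ae]; exists e' => // x xe xlt0; apply: Ae => //.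
  exact: ltr0_neq0.
- rewrite -[X in _ --> X]subr0 -[X in _ - X](mul0r (D / 2)).
  apply: cvgB; first exact: cvg_cst.
  apply: cvgM; last exact: cvg_cst.
  exact: cvg_within.
- near=> h; apply: quot.
  + by near: h; exists 1 => /=.
  + by near: h; exists e => //= x; rewrite /ball_ /= sub0r normrN.
  + by near: h; exists t => //= x; rewrite /ball_ /= sub0r normrN.
Unshelve. all: by end_near.
Qed.

End FirstOrder.

(** * Events of high probability *)

Section HighProbability.
Context {R : realType} {d : measure_display} {T : measurableType d}.
Variable P : probability T R.

(* [A] is there because [E n] itself need not be measurable. *)
Definition mostly (E : nat -> set T) (eps : R) : Prop :=
  \forall n \near \oo, exists A, [/\ measurable A, ~` E n `<=` A &
    (P A <= eps%:E)%E].

Lemma mostly_sub (E F : nat -> set T) eps :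
  (\forall n \near \oo, E n `<=` F n) -> mostly E eps -> mostly F eps.
Proof.
move=> EF mE; near=> n.
have [//|A [mA EA PA]] := near mE n.
exists A; split => //; apply: subset_trans EA; apply: subsetC.
by near: n.
Unshelve. all: by end_near. Qed.

Lemma mostlyI (E F : nat -> set T) eps1 eps2 :
  mostly E eps1 -> mostly F eps2 ->
  mostly (fun n => E n `&` F n) (eps1 + eps2).
Proof.
move=> mE mF; near=> n.
have [//|A [mA EA PA]] := near mE n.
have [//|B [mB FB PB]] := near mF n.
exists (A `|` B); split; first exact: measurableU.
  by rewrite setCI => w [/EA|/FB]; [left|right].
apply: (@le_trans _ _ (P A + P B)%E).
  exact: measureU2.
by rewrite EFinD leeD.
Unshelve. all: by end_near. Qed.

Lemma mostlyT (E : nat -> set T) eps : 0 <= eps -> (forall n, E n = setT) ->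
  mostly E eps.
Proof.
move=> eps0 ET; apply: nearW => n; exists set0.
by rewrite ET setCT measure0 lee_fin; split.
Qed.

Lemma with_prob_to_one_mostly (E : nat -> set T) eps : 0 < eps ->
  with_prob_to_one P E -> mostly E eps.
Proof.
move=> eps0 [A [mA AE PA]].
have eps1 : ((1 - eps)%:E < 1%:E)%E by rewrite lte_fin gtrBl.
have hP : \forall n \near \oo, ((1 - eps)%:E < P (A n))%E.
  exact: PA _ (open_ereal_gt' eps1).
near=> n; exists (~` A n); split.
- exact: measurableC.
- exact: subsetC.
rewrite probability_setC//.
have Pfin : P (A n) \is a fin_num by exact: fin_num_measure.
have : ((1 - eps)%:E < P (A n))%E.
  by near: n.
by rewrite -(fineK Pfin) -EFinB lte_fin lee_fin; lra.
Unshelve. all: by end_near. Qed.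

Lemma mostly_cvg1 (E : nat -> set T) : (forall n, measurable (E n)) ->
  (forall eps, 0 < eps -> mostly E eps) -> P (E n) @[n --> \oo] --> (1%:E : \bar R).
Proof.
move=> mE hE.
have Pfin n : P (E n) \is a fin_num by exact: fin_num_measure.
apply/fine_cvgP; split; first exact: nearW.
apply/cvgrPdist_le => eps eps0; near=> n.
have [|A [mA EA PA]] := near (hE eps eps0) n; first by [].
have : (P (~` E n) <= eps%:E)%E.
  by apply: le_trans PA; apply: le_measure; rewrite ?inE//; exact: measurableC.
rewrite probability_setC// -(fineK (Pfin n)) -EFinB lee_fin.
have : (P (E n) <= 1)%E by exact: probability_le1.
rewrite -{1}(fineK (Pfin n)) lee_fin /= => h1 h2.
by rewrite ger0_norm// subr_ge0.
Unshelve. all: by end_near. Qed.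

(* [Y n = O_P(r n)], phrased with [mostly] so that it can be intersected. *)
Definition tight (Y : nat -> T -> R) (r : nat -> R) : Prop :=
  forall eps, 0 < eps -> exists2 M, 0 < M &
    mostly (fun n => [set w | `|Y n w| <= M * r n]) eps.

(** Union bound along a list, halving [eps] at each element. The constants are added, and [r n >= 0]
    lets the sum dominate each of them. *)
Lemma tight_forall (I : finType) (Y : I -> nat -> T -> R) (r : nat -> R) :
  (forall n, 0 <= r n) -> (forall i, tight (Y i) r) ->
  forall eps, 0 < eps -> exists2 M, 0 < M &
    mostly (fun n => [set w | forall i, `|Y i n w| <= M * r n]) eps.
Proof.
move=> r0 tY.
suff H (s : seq I) eps : 0 < eps -> exists2 M, 0 < M &
    mostly (fun n => [set w | forall i, i \in s -> `|Y i n w| <= M * r n]) eps.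
  move=> eps eps0; have [M M0 hM] := H (enum I) eps eps0; exists M => //.
  apply: mostly_sub hM; apply: nearW => n w /= h i.
  by apply: h; rewrite mem_enum.
elim: s eps => [|a s IH] eps eps0.
  by exists 1 => //; apply: mostlyT => [|n]; [exact: ltW|apply/seteqP; split].
have eps20 : 0 < eps / 2 by rewrite divr_gt0.
have [M1 M10 h1] := IH _ eps20; have [M2 M20 h2] := tY a _ eps20.
exists (M1 + M2); first exact: addr_gt0.
have := mostlyI h1 h2; rewrite -splitr; apply: mostly_sub.
apply: nearW => n w /= [hs ha] i; rewrite inE => /orP[/eqP ->|/hs hi].
  by apply: (le_trans ha); rewrite ler_wpM2r// lerDr ltW.
by apply: (le_trans hi); rewrite ler_wpM2r// lerDl ltW.
Qed.

Lemma bounded_in_prob_tight (Y : nat -> T -> R) (r : nat -> R) :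
  (forall n, measurable_fun setT (Y n)) -> bounded_in_prob P Y r -> tight Y r.
Proof.
move=> mY bY eps eps0; have [M M0 hM] := bY eps eps0; exists M => //.
near=> n; exists [set w | M * r n < `|Y n w|]; split.
- have -> : [set w | M * r n < `|Y n w|] = (fun w => `|Y n w|) @^-1` `]M * r n, +oo[.
    by apply/seteqP; split=> w; rewrite /= in_itv/= andbT.
  rewrite -[X in measurable X]setTI.
  exact: (measurableT_comp (@normr_measurable R setT) (mY n)).
- by move=> w /= /negP; rewrite -ltNge.
- by near: n.
Unshelve. all: by end_near. Qed.

End HighProbability.

(** The lower limit is the limit of the nondecreasing tail infima, which eventually exceed any real
    strictly below it and which bound [u] from below. *)
Lemma limn_einf_gt0 (R : realType) (u : nat -> \bar R) : (0 < limn_einf u)%E ->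
  exists2 c : R, 0 < c & \forall n \near \oo, (c%:E <= u n)%E.
Proof.
rewrite limn_einf_lim => h.
have [c c0 hc] : exists2 c : R, 0 < c & (c%:E < limn (einfs u))%E.
  case: (limn (einfs u)) h => [l| |]//.
    rewrite lte_fin => l0; exists (l / 2); first by rewrite divr_gt0.
    by rewrite lte_fin; lra.
  by exists 1 => //; rewrite ltry.
exists c => //; near=> n.
apply: (@le_trans _ _ (einfs u n)); last first.
  by apply: ereal_inf_lbound; exists n => /=.
near: n; apply: lte_lim => //; first exact: nondecreasing_einfs.
exact: is_cvg_einfs.
Unshelve. all: by end_near. Qed.

(** * Tightness of the score *)

Section Score.
Context {R : realType} {p : nat}.
Implicit Types (U V : 'M[R]_p).

Lemma ler_enorm V k l : `|V k l| <= enorm V.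
Proof.
rewrite -sqrtr_sqr; apply: ler_wsqrtr.
rewrite (bigD1 k)//= (bigD1 l)//= -addrA lerDl.
by apply: addr_ge0; do ?apply: sumr_ge0 => *; rewrite ?sumr_ge0 ?sqr_ge0// => *; exact: sqr_ge0.
Qed.

Lemma Rpart_sub_Phipart_le V k l : `|(Rpart V - Phipart V) k l| <= enorm V.
Proof.
rewrite Rpart_sub_PhipartE; have [->|kl] := eqVneq k l.
  by rewrite Phipart_diag subr0 mulr1n ler_enorm.
by rewrite mulr0n sub0r normrN Phipart_offdiag// ler_enorm.
Qed.

(** By linearity the difference is the Gram matrix of [X] applied to the residual matrix of
    [U - U0]. Each Gram entry is at most [N] since [|ab| <= (a^2 + b^2) / 2], each residual entry is
    at most [r], and there are [p] terms. *)
Lemma score_sub_le n (X : 'M[R]_(n, p)) U U0 (N r : R) i j :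
  (forall l, \sum_k X k l ^+ 2 <= N) -> enorm (U - U0) <= r ->
  `|score X U i j - score X U0 i j| <= p%:R * (N * r).
Proof.
move=> hN hr.
have N0 : 0 <= N by apply: le_trans (hN i); apply: sumr_ge0 => k _; exact: sqr_ge0.
have -> : score X U i j - score X U0 i j =
    \sum_l (X^T *m X) i l * (Rpart (U - U0) - Phipart (U - U0)) l j.
  transitivity ((X^T *m (X *m (Rpart (U - U0) - Phipart (U - U0)))) i j); last first.
    by rewrite mulmxA mxE.
  have -> : Rpart (U - U0) - Phipart (U - U0) =
      (Rpart U - Phipart U) - (Rpart U0 - Phipart U0).
    by apply/matrixP => k l; rewrite !mxE; ring.
  by rewrite /score !mulmxBr; rewrite !mxE; ring.
apply: le_trans (ler_norm_sum _ _ _) _.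
rewrite -[X in X%:R]card_ord mulr_natl -sumr_const; apply: ler_sum => l _.
rewrite normrM ler_pM//; last exact: le_trans (Rpart_sub_Phipart_le _ _ _) hr.
rewrite mxE; apply: le_trans (ler_norm_sum _ _ _) _.
apply: (@le_trans _ _ (\sum_k (X k i ^+ 2 / 2 + X k l ^+ 2 / 2))).
  apply: ler_sum => k _; rewrite [X^T _ _]mxE ler_norml.
  have := sqr_ge0 (X k i + X k l); have := sqr_ge0 (X k i - X k l).
  by rewrite !sqrrD sqrrN => ? ?; apply/andP; split; lra.
rewrite big_split/= -!mulr_suml; have := hN i; have := hN l; lra.
Qed.

(* Polarization: x_i . X a = (|X (e_i + a)|^2 - |X (e_i - a)|^2) / 4. *)
Lemma score_polar n (X : 'M[R]_(n, p)) U i j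
    (a := col j (Rpart U - Phipart U)) (b := delta_mx i 0 : 'cV[R]_p) :
  score X U i j = (\sum_k (X *m (b + a)) k 0 ^+ 2
                   - \sum_k (X *m (b - a)) k 0 ^+ 2) / 4.
Proof.
rewrite mxE -sumrB mulr_suml; apply: eq_bigr => k _.
rewrite [X^T _ _]mxE.
have -> : (X *m (Rpart U - Phipart U)) k j = (X *m a) k 0.
  by rewrite /a colE mulmxA -colE [RHS]mxE.
rewrite (mulmxDr X b a) (mulmxBr X b a) /b -colE; move: (X *m a) => v.
have -> : (col i X + v) k 0 = X k i + v k 0 by rewrite !mxE.
have -> : (col i X - v) k 0 = X k i - v k 0 by rewrite !mxE.
by field.
Qed.

End Score.

Section Tightness.
Context {R : realType} {d : measure_display} {T : measurableType d}.
Variable P : probability T R.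
Context {p : nat} (Sigma0 : 'M[R]_p) (X : forall n : nat, T -> 'M[R]_(n, p)).
Hypothesis posS : posdefmx Sigma0.
Hypothesis hX : forall n : nat, iid_gaussian_rows P Sigma0 (X n).

Lemma sqnorm_tight (c : 'cV[R]_p) (s : R) :
  s = Num.sqrt ((c^T *m Sigma0 *m c) 0 0) -> c != 0 ->
  tight P (fun n w => \sum_k (X n w *m c) k 0 ^+ 2 - n%:R * normal_moment s 2)
    (fun n => Num.sqrt n%:R).
Proof.
move=> sE c0 eps eps0.
(* At deviation [M sqrt n] Chebyshev's bound is [v / M^2], so [M^2 >= |v| / eps] suffices; the added
   1 keeps [M] positive. *)
set v := normal_moment s 4; pose M := Num.sqrt (`|v| / eps) + 1.
have M1 : 1 <= M by rewrite lerDr sqrtr_ge0.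
have M0 : 0 < M by apply: lt_le_trans M1.
have vM : v <= eps * M ^+ 2.
  have h : Num.sqrt (`|v| / eps) ^+ 2 = `|v| / eps.
    by rewrite sqr_sqrtr// divr_ge0// ltW.
  have h2 : `|v| / eps <= M ^+ 2.
    by rewrite -h lerXn2r ?nnegrE ?sqrtr_ge0 ?(ltW M0)// lerDl.
  apply: (le_trans (ler_norm _)).
  by rewrite mulrC -ler_pdivrMr.
exists M => //; near=> n.
have n0 : 0 < n%:R :> R by rewrite ltr0n; near: n; exists 1%N.
have eps'0 : 0 < M * Num.sqrt n%:R by rewrite mulr_gt0// sqrtr_gt0.
set Y := fun w => \sum_k (X n w *m c) k 0 ^+ 2 - n%:R * normal_moment s 2.
exists [set w | M * Num.sqrt n%:R <= `|Y w|]; split.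
- have mY : measurable_fun setT Y.
    apply: measurable_funB => //; apply: measurable_sum => k.
    apply: measurable_funX.
    have [gX _] := hX n; have [mk _] := gX k.
    have -> : (fun w => (X n w *m c) k 0) = (fun w => (row k (X n w) *m c) 0 0).
      by apply/funext => w; rewrite -row_mul [RHS]mxE.
    exact: measurable_mulmx_coord.
  have -> : [set w | M * Num.sqrt n%:R <= `|Y w|] =
      (fun w => `|Y w|) @^-1` `[M * Num.sqrt n%:R, +oo[.
    by apply/seteqP; split=> w; rewrite /= in_itv/= andbT.
  rewrite -[X in measurable X]setTI.
  exact: (measurableT_comp (@normr_measurable R setT) mY).
- by move=> w /= /negP; rewrite -ltNge => /ltW.
- apply: le_trans (gaussian_sqnorm_chebyshev sE posS (hX n) c0 eps'0) _.
  rewrite lee_fin exprMn sqr_sqrtr ?ler0n// -/v ler_pdivrMr; last first.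
    by rewrite mulr_gt0// exprn_gt0.
  by rewrite mulrA [X in _ <= X]mulrC ler_wpM2l// ltW.
Unshelve. all: by end_near. Qed.

Lemma quadform_neq0 (c : 'cV[R]_p) :
  (c^T *m Sigma0 *m c) 0 0 != 0 -> c != 0.
Proof. by apply: contraNneq => ->; rewrite mulmx0 mxE. Qed.

(** With [c] the [l]-th basis vector, the sum is [n m] plus a deviation [O_P(sqrt n)], and
    [sqrt n <= n] for [n >= 1]. *)
Lemma colnorm_tight l :
  tight P (fun n w => \sum_k X n w k l ^+ 2) (fun n => n%:R).
Proof.
move=> eps eps0.
pose c : 'cV[R]_p := delta_mx l 0.
have c0 : c != 0.
  by apply/eqP => /colP/(_ l); rewrite !mxE !eqxx => /eqP; rewrite oner_eq0.
have [M M0 hM] := sqnorm_tight erefl c0 eps0.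
set m := normal_moment _ 2 in hM.
exists (M + `|m|); first by rewrite ltr_wpDr.
apply: mostly_sub hM; near=> n => w /=.
have -> : \sum_k (X n w *m c) k 0 ^+ 2 = \sum_k X n w k l ^+ 2.
  by apply: eq_bigr => k _; rewrite -colE mxE.
have n1 : 1 <= n%:R :> R by rewrite ler1n; near: n; exists 1%N.
have sn : Num.sqrt n%:R <= n%:R :> R.
  rewrite -[X in _ <= X](@sqr_sqrtr _ n%:R) ?ler0n// ler_eXnr//.
  by rewrite -[X in X <= _]sqrtr1 ler_wsqrtr.
set S := \sum_k _ => h.
have -> : S = (S - n%:R * m) + n%:R * m by rewrite subrK.
apply: (le_trans (ler_normD _ _)); rewrite mulrDl lerD//.
  by apply: (le_trans h); rewrite ler_wpM2l// ltW.
by rewrite normrM ger0_norm ?ler0n// mulrC.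
Unshelve. all: by end_near. Qed.

(** The vanishing covariance makes [b] and [a] orthogonal for [Sigma0], so [b + a] and [b - a] have
    the same variance. The two squared norms in the polarization then share one centring, which
    cancels in their difference. *)
Lemma score_tight (U0 : 'M[R]_p) i j : equivDAGs Sigma0 U0 ->
  (Sigma0 *m (Rpart U0 - Phipart U0)) i j = 0 ->
  tight P (fun n w => score (X n w) U0 i j) (fun n => Num.sqrt n%:R).
Proof.
move=> eqU0 cov0 eps eps0.
pose b : 'cV[R]_p := delta_mx i 0; pose a := col j (Rpart U0 - Phipart U0).
have b0 : b != 0.
  by apply/eqP => /colP/(_ i); rewrite !mxE !eqxx => /eqP; rewrite oner_eq0.
have bSa : b^T *m Sigma0 *m a = 0.
  rewrite /a colE mulmxA -(mulmxA _ Sigma0) /b trmx_delta -rowE -colE.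
  by apply/matrixP => k l; rewrite [LHS]mxE [LHS]mxE cov0 mxE.
have aSb : a^T *m Sigma0 *m b = 0.
  by rewrite -(trmxK b) -{1}(proj1 posS) -mulmxA -trmx_mul -trmx_mul bSa trmx0.
have qp : ((b + a)^T *m Sigma0 *m (b + a)) 0 0 =
    (b^T *m Sigma0 *m b) 0 0 + (a^T *m Sigma0 *m a) 0 0.
  by rewrite [(b + a)^T]raddfD/= !mulmxDl !mulmxDr bSa aSb addr0 add0r mxE.
have qm : ((b - a)^T *m Sigma0 *m (b - a)) 0 0 =
    (b^T *m Sigma0 *m b) 0 0 + (a^T *m Sigma0 *m a) 0 0.
  by rewrite [(b - a)^T]raddfB/= !mulmxBl !mulmxBr bSa aSb subr0 sub0r opprK mxE.
have bb : 0 < (b^T *m Sigma0 *m b) 0 0 by apply: (proj2 posS).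
have aa : 0 <= (a^T *m Sigma0 *m a) 0 0.
  have [->|a0] := eqVneq a 0; first by rewrite mulmx0 mxE.
  by rewrite ltW// (proj2 posS).
(* The common variance is positive because of the [b] term alone, whence both [b + a] and [b - a]
   are nonzero. *)
have q0 : (b^T *m Sigma0 *m b) 0 0 + (a^T *m Sigma0 *m a) 0 0 != 0.
  by rewrite gt_eqF// ltr_wpDr.
have p0 : b + a != 0 by apply: quadform_neq0; rewrite qp.
have m0 : b - a != 0 by apply: quadform_neq0; rewrite qm.
have eps20 : 0 < eps / 2 by rewrite divr_gt0.
pose s := Num.sqrt ((b^T *m Sigma0 *m b) 0 0 + (a^T *m Sigma0 *m a) 0 0).
have sp : s = Num.sqrt (((b + a)^T *m Sigma0 *m (b + a)) 0 0) by rewrite qp.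
have sm : s = Num.sqrt (((b - a)^T *m Sigma0 *m (b - a)) 0 0) by rewrite qm.
have [M1 M10 h1] := sqnorm_tight sp p0 eps20.
have [M2 M20 h2] := sqnorm_tight sm m0 eps20.
exists (M1 + M2); first exact: addr_gt0.
have := mostlyI h1 h2; rewrite -splitr; apply: mostly_sub.
apply: nearW => n w /= []; rewrite score_polar -/a -/b mulrDl.
set S1 := \sum_k _; set S2 := \sum_k _.
rewrite !ler_norml => /andP[? ?] /andP[? ?].
by apply/andP; split; lra.
Qed.

End Tightness.

(** * Support recovery *)

Lemma measurable_enorm (R : realType) d (T : measurableType d) m n
    (A : T -> 'M[R]_(m, n)) (B : 'M[R]_(m, n)) :
  random_mx A -> measurable_fun setT (fun w => enorm (A w - B)).
Proof.
move=> mA.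
apply: (measurableT_comp (continuous_measurable_fun (@sqrt_continuous R))).
apply: measurable_sum => i; apply: measurable_sum => j; apply: measurable_funX.
have -> : (fun w => (A w - B) i j) = (fun w => A w i j - B i j).
  by apply/funext => w; rewrite !mxE.
by apply: measurable_funB => //; exact: random_mx_coord.
Qed.

Lemma measurable_supp_eq (R : realType) p d (T : measurableType d)
    (A : T -> 'M[R]_p) (U0 : 'M[R]_p) :
  random_mx A -> measurable [set w | supp (A w) = supp U0].
Proof.
move=> mA.
have -> : [set w | supp (A w) = supp U0] =
    \bigcap_(ij in [set: 'I_p * 'I_p])
      [set w | (A w ij.1 ij.2 != 0) = (U0 ij.1 ij.2 != 0)].
  apply/seteqP; split => w /=.
    by move=> h ij _; have := congr1 (fun S : {set _} => ij \in S) h; rewrite !inE.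
  by move=> h; apply/setP => ij; rewrite !inE; exact: h.
apply: fin_bigcap_measurable; first exact: finite_finset.
move=> ij _; have mij := random_mx_coord ij.1 ij.2 mA.
have m0 : measurable [set w | A w ij.1 ij.2 = 0].
  by rewrite -[X in measurable X]setTI; exact: (mij measurableT [set 0]).
case: (U0 ij.1 ij.2 != 0).
- rewrite (_ : [set _ | _] = ~` [set w | A w ij.1 ij.2 = 0]).
    exact: measurableC.
  by apply/seteqP; split => w /= /eqP.
- rewrite (_ : [set _ | _] = [set w | A w ij.1 ij.2 = 0])//.
  by apply/seteqP; split => w /= => [/negbFE/eqP|->]; rewrite ?eqxx.
Qed.

Lemma entry_gap (R : realType) p (U0 : 'M[R]_p) :
  exists2 g : R, 0 < g & forall i j, U0 i j != 0 -> g <= `|U0 i j|.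
Proof.
(* The default 1 keeps the gap positive when [U0] has no nonzero entry. *)
exists (\big[Num.min/1]_(ij : 'I_p * 'I_p | U0 ij.1 ij.2 != 0) `|U0 ij.1 ij.2|).
  by apply: (big_ind (fun x => 0 < x)) => // [x y x0 y0|ij];
    rewrite ?lt_min ?x0 ?y0 ?normr_gt0.
by move=> i j ij; apply: (bigmin_le_cond _ (fun ij => `|U0 ij.1 ij.2|) (j := (i, j))).
Qed.

(** The deterministic core. As [r < g], no nonzero entry of [U0] is lost. A spurious entry of [U]
    has modulus in the steep range up to [r], so the first-order condition forces a score of at
    least [n * slope], whereas the score at [U] is at most [B + p N r]. *)
Lemma supp_recovery (R : realType) p (Sigma0 U0 U : 'M[R]_p) n
    (X : 'M[R]_(n, p)) (pen : R -> R) (g r N B slope : R) :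
  posdefmx Sigma0 -> equivDAGs Sigma0 U0 ->
  (forall i j, U0 i j != 0 -> g <= `|U0 i j|) -> r < g ->
  local_maximizer DAGspace (objective X pen) U ->
  enorm (U - U0) <= r ->
  (forall l, \sum_k X k l ^+ 2 <= N) ->
  (forall i j, (Sigma0 *m (Rpart U0 - Phipart U0)) i j = 0 ->
     `|score X U0 i j| <= B) ->
  (forall t, 0 < t <= r -> derivable pen t 1 /\ slope <= derive1 pen t) ->
  B + p%:R * (N * r) < n%:R * slope ->
  supp U = supp U0.
Proof.
move=> posS eqU0 hg rg maxU hr hN hB hpen hslope.
have dU : DAGspace U by case: maxU.
have le_entry i j : `|U i j - U0 i j| <= r.
  by apply: le_trans hr; have := ler_enorm (U - U0) i j; rewrite !mxE.
have sub i j : U0 i j != 0 -> U i j != 0.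
  move=> /hg h; apply: contraTneq (le_entry i j) => ->.
  by rewrite sub0r normrN -ltNge (lt_le_trans rg).
apply/setP => -[i j]; rewrite !inE /=.
have [u0|u0] := eqVneq (U0 i j) 0; last exact: sub.
apply/negbTE/negP => uij.
have ij : i != j.
  apply: contra_eq_neq u0 => ->; have [[_ rho0] _] := eqU0.
  by have := rho0 j; rewrite mxE => /lt0r_neq0.
have t0 : 0 < `|U i j| <= r.
  by rewrite normr_gt0 uij /=; have := le_entry i j; rewrite u0 subr0.
have [dpen slope_le] := hpen _ t0.
have cov0 := supp_edge_cov0 posS eqU0 dU sub ij uij.
have := local_maximizer_score maxU ij uij dpen.
apply/negP; rewrite -ltNge; apply: le_lt_trans (lt_le_trans hslope _); last first.
  by rewrite ler_wpM2l.
have -> : score X U i j = score X U0 i j + (score X U i j - score X U0 i j).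
  by rewrite addrC subrK.
by apply: (le_trans (ler_normD _ _)); rewrite lerD ?hB ?score_sub_le.
Qed.

Theorem theorem2 (R : realType) (p : nat) (hp : (1 <= p)%N)
    (Sigma0 : 'M[R]_p) (hSigma0 : posdefmx Sigma0)
    (d : measure_display) (T : measurableType d) (P : probability T R)
    (X : forall n : nat, T -> 'M[R]_(n, p))
    (hX : forall n : nat, iid_gaussian_rows P Sigma0 (X n))
    (pen : R -> R -> R) (lam : nat -> R)
    (hpen_ge0 : forall l t : R, 0 < l -> 0 <= t -> 0 <= pen l t)
    (hpen_mono : forall l s t : R, 0 < l -> 0 <= s -> s <= t -> pen l s <= pen l t)
    (hpen_steep : steep_at_origin pen lam)
    (U0 : 'M[R]_p) (hU0 : equivDAGs Sigma0 U0)
    (hpen_C2 : \forall n \near \oo, forall i j : 'I_p, Phipart U0 i j != 0 ->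
       twice_derivable_at (pen (lam n)) `|Phipart U0 i j|)
    (ha : (fun n : nat => pen_a (pen (lam n)) U0) =O_\oo
          (fun n : nat => (Num.sqrt n%:R)^-1 : R))
    (hb : pen_b (pen (lam n)) U0 @[n --> \oo] --> (0 : R))
    (Uhat : nat -> T -> 'M[R]_p)
    (hUhat_meas : forall n : nat, random_mx (Uhat n))
    (hUhat_max : with_prob_to_one P (fun n : nat =>
       [set w | local_maximizer DAGspace
                  (objective (X n w) (pen (lam n))) (Uhat n w)]))
    (hUhat_rate : bounded_in_prob P (fun n w => enorm (Uhat n w - U0))
       (fun n : nat => (Num.sqrt n%:R)^-1 + pen_a (pen (lam n)) U0))
    (hlam0 : lam n @[n --> \oo] --> (0 : R))
    (hlam_oo : lam n * Num.sqrt n%:R @[n --> \oo] --> +oo) :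
  P [set w | supp (Uhat n w) = supp U0] @[n --> \oo] --> (1%:E : \bar R).
Proof.
have [Ca Ca0 hCa] : exists2 Ca : R, 0 < Ca &
    \forall n \near \oo, pen_a (pen (lam n)) U0 <= Ca * (Num.sqrt n%:R)^-1.
  have /eqO_exP[Ca Ca0 hCa] := ha; exists Ca => //.
  apply: filterS hCa => n /=; rewrite (@ger0_norm _ (Num.sqrt _)^-1) ?invr_ge0 ?sqrtr_ge0//.
  exact/le_trans/ler_norm.
have [g g0 hg] := entry_gap U0.
apply: mostly_cvg1 => [n|eps eps0]; first exact: measurable_supp_eq.
have eps4 : 0 < eps / 4 by rewrite divr_gt0.
have [M2 M20 h2] : exists2 M, 0 < M & mostly P (fun n => [set w |
    `|enorm (Uhat n w - U0)| <= M * ((Num.sqrt n%:R)^-1 + pen_a (pen (lam n)) U0)])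
    (eps / 4).
  apply: (bounded_in_prob_tight _ hUhat_rate eps4) => n; exact: measurable_enorm.
have [M3 M30 h3] := tight_forall (fun n => ler0n _ n)
  (colnorm_tight hSigma0 hX) eps4.
(* Only centred scores are tight; the others are replaced by 0 so that one bound holds over all
   pairs. *)
pose Y (ij : 'I_p * 'I_p) n w :=
  if (Sigma0 *m (Rpart U0 - Phipart U0)) ij.1 ij.2 == 0
  then score (X n w) U0 ij.1 ij.2 else 0.
have tY ij : tight P (Y ij) (fun n => Num.sqrt n%:R).
  rewrite /Y; case: eqP => [cov0|_].
    exact: (score_tight hSigma0 hX hU0 cov0).
  move=> e e0; exists 1 => //; apply: mostlyT; first exact: ltW.
  by move=> n; apply/seteqP; split => w //= _; rewrite normr0 mul1r sqrtr_ge0.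
have [M4 M40 h4] := tight_forall (fun n => sqrtr_ge0 n%:R) tY eps4.
have h1 := with_prob_to_one_mostly eps4 hUhat_max.
(* Since [a_n <= Ca / sqrt n], the estimator lies within [C / sqrt n] of [U0]; steepness is invoked
   on this window. *)
pose C := M2 * (1 + Ca).
have C0 : 0 < C by rewrite mulr_gt0// addr_gt0.
have [hder hsteep] := hpen_steep C C0.
have [c c0 hc] := limn_einf_gt0 hsteep.
have epsE : eps = eps / 4 + eps / 4 + (eps / 4 + eps / 4) by field.
have := mostlyI (mostlyI h1 h2) (mostlyI h3 h4); rewrite -epsE.
apply: mostly_sub; near=> n.
have n0 : 0 < n%:R :> R by rewrite ltr0n; near: n; exists 1%N.
have sn0 : 0 < Num.sqrt n%:R :> R by rewrite sqrtr_gt0.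
have sn2 : Num.sqrt n%:R * Num.sqrt n%:R = n%:R :> R by rewrite -expr2 sqr_sqrtr// ltW.
(* The threshold is the final inequality [M4 sqrt n + p M3 n (C / sqrt n) < n c lam n] divided by
   [c sqrt n]. *)
have lamn : (M4 + p%:R * (M3 * C)) / c < lam n * Num.sqrt n%:R.
  by near: n; move/cvgryPgt : hlam_oo; apply.
(* Positivity of [lam n] follows from the nonnegative threshold; it turns the bound on the ratio
   [p' / lam] into [c lam n <= p']. *)
have lam0 : 0 < lam n.
  rewrite -(pmulr_lgt0 _ sn0); apply: le_lt_trans lamn.
  have MC0 : 0 <= M3 * C by rewrite mulr_ge0 ?ltW.
  have pMC0 : 0 <= p%:R * (M3 * C) by exact: mulr_ge0.
  by apply: divr_ge0; [apply: addr_ge0 => //; exact: ltW|exact: ltW].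
(* This holds as soon as [n > (C / g)^2]. *)
have rg : C / Num.sqrt n%:R < g.
  rewrite ltr_pdivrMr// -ltr_pdivrMl//.
  have gC0 : 0 <= g^-1 * C by rewrite mulr_ge0 ?invr_ge0 ?ltW.
  rewrite -(ger0_norm gC0) -sqrtr_sqr ltr_sqrt//.
  by near: n; exact: nbhs_infty_gtr.
have han : pen_a (pen (lam n)) U0 <= Ca * (Num.sqrt n%:R)^-1 by near: n.
have dern t : 0 < t <= C / Num.sqrt n%:R -> derivable (pen (lam n)) t 1.
  by move: t; near: n.
have hcn : (c%:E <= ereal_inf [set (derive1 (pen (lam n)) t / lam n)%:E | t in
    [set t : R | (0 < t <= C / Num.sqrt n%:R)%R]])%E by near: n.
move=> w [[/= maxU hr] [hN hB]].
apply: (@supp_recovery _ _ Sigma0 U0 _ n (X n w) (pen (lam n)) g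
  (C / Num.sqrt n%:R) (M3 * n%:R) (M4 * Num.sqrt n%:R) (c * lam n)) => //.
- apply: (le_trans (ler_norm _)); apply: (le_trans hr).
  by rewrite /C -mulrA ler_wpM2l ?(ltW M20)// mulrDl mul1r lerD2l.
- by move=> l; apply: (le_trans (ler_norm _)); exact: hN.
- by move=> i j cov0; have := hB (i, j); rewrite /Y /= cov0 eqxx.
- move=> t ht; split; first exact: dern.
  have : (ereal_inf [set (derive1 (pen (lam n)) t / lam n)%:E | t in
     [set t : R | (0 < t <= C / Num.sqrt n%:R)%R]] <=
     (derive1 (pen (lam n)) t / lam n)%:E)%E by apply: ereal_inf_lbound; exists t.
  by move=> /(le_trans hcn); rewrite lee_fin ler_pdivlMr.
- move: lamn; rewrite ltr_pdivrMr// -(ltr_pM2l sn0) => lamn.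
  have -> : n%:R * (c * lam n) = Num.sqrt n%:R * (lam n * Num.sqrt n%:R * c).
    by rewrite -{1}sn2; ring.
  apply: le_lt_trans lamn.
  have -> : p%:R * (M3 * n%:R * (C / Num.sqrt n%:R)) =
     Num.sqrt n%:R * (p%:R * (M3 * C)).
    by rewrite -{1}sn2; field; rewrite gt_eqF.
  by rewrite mulrDr mulrC.
Unshelve. all: by end_near.
Qed.
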